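(* Let $S$ be a group and let $\psi\colon X\to X'$ be a morphism of $S$-axets. Then (1) the image $\psi(X)$ is a subaxet of $X'$; (2) the equivalence relation $\sim$ on $X$ given by $x\sim y$ if and only if $\psi(x)=\psi(y)$ is a congruence on $X$; and (3) $\psi(X)\cong X/\!\sim$ as axets.
   Context: Actions are right actions. An $S$-axet $(G,X,\tau)$ consists of a group $G$, a $G$-set $X$ and a map $\tau\colon X\times S\to G$, written $\tau_x(s)$, such that for all $x\in X$, $s,s'\in S$, $g\in G$: $\tau_x(s)\in G_x$; $\tau_x(ss')=\tau_x(s)\tau_x(s')$; $\tau_{xg}(s)=g^{-1}\tau_x(s)g$. $\mathrm{Miy}(X)=\langle\tau_x(s):x\in X,s\in S\rangle$. A subset $Y\subseteq X$ is closed if it is invariant under $\tau_y(s)$ for all $y\in Y,s\in S$; a subaxet is $(H,Y,\sigma)$ with $Y$ closed, $H$ the setwise stabiliser of $Y$ in $G$ and $\sigma=\tau|_{Y\times S}$. A morphism $(G,X,\tau)\to(G',X',\tau')$ is a map of sets $\psi\colon X\to X'$ with $\psi(y\tau_x(s))=\psi(y)\tau'_{\psi(x)}(s)$ for all $x,y\in X$, $s\in S$; an isomorphism is a bijective morphism. A congruence on $X$ is an equivalence relation $\sim$ such that $x\sim y$ and $z\sim w$ imply $x\tau_z(s)\sim y\tau_w(s)$ for all $s\in S$. The factor axet $X/\!\sim$ is $(\bar G,\bar X,\bar\tau)$ where $\bar X$ is the set of congruence classes $[x]$, $\bar G$ is the permutation group induced by $\mathrm{Miy}(X)$ on $\bar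 X$ (via $[x]g=[xg]$), and $\bar\tau_{[x]}(s)$ is the permutation of $\bar X$ induced by $\tau_x(s)$ (this is well defined). *)

(* Defs.v *)
From HB Require Import structures.
From mathcomp Require Import all_boot.
From mathcomp Require Import boolp classical_sets.

Set Implicit Arguments.
Unset Strict Implicit.
Unset Printing Implicit Defensive.

Local Open Scope group_scope.
Local Open Scope classical_set_scope.
Local Open Scope quotient_scope.

(* [groupType] includes infinite groups.  Since [boolp] gives every type a choice
   structure, asking groups and G-sets to be [choiceType]s loses no generality,
   and neither does describing equivalence relations by boolean [rel]s. *)

Section SubgroupType.
Variables (G : groupType) (H : set G) (hH : group_closed (mem H)).

Definition subgroup_type of group_closed (mem H) := {g : G | g \in H}.

HB.instance Definition _ := SubChoice.copy (subgroup_type hH) {g : G | g \in H}.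
HB.instance Definition _ :=
  SubChoice_isSubGroup.Build G (mem H) (subgroup_type hH) hH.

End SubgroupType.

Section Symmetric.
Variable T : Type.

Record sym := Sym {
  sym_fun :> T -> T;
  sym_inv : T -> T;
  symK : cancel sym_fun sym_inv;
  symVK : cancel sym_inv sym_fun }.

Lemma symP (p q : sym) : p =1 q -> p = q.
Proof.
case: p q => [f f' fK f'K] [g g' gK g'K] /= /funext fg.
rewrite -fg in gK g'K *; have f'g' : f' = g'.
  by apply/funext => x; rewrite -{1}[x]g'K fK.
by rewrite -f'g' in gK g'K *; congr Sym; exact: Prop_irrelevance.
Qed.

HB.instance Definition _ := gen_eqMixin sym.
HB.instance Definition _ := gen_choiceMixin sym.

(* Permutations act on the right: [p * q] is [p] followed by [q]. *)
Definition sym_mul (p q : sym) : sym :=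
  Sym (can_comp (symK q) (symK p)) (can_comp (symVK p) (symVK q)).
Definition sym_one : sym := @Sym id id (fun=> erefl) (fun=> erefl).
Definition sym_V (p : sym) : sym := Sym (symVK p) (symK p).

Fact sym_mulA : associative sym_mul.
Proof. by move=> p q r; apply: symP. Qed.
Fact sym_mul1 : left_id sym_one sym_mul.
Proof. by move=> p; apply: symP. Qed.
Fact sym_mulr1 : right_id sym_one sym_mul.
Proof. by move=> p; apply: symP. Qed.
Fact sym_mulV : left_inverse sym_one sym_V sym_mul.
Proof. by move=> p; apply: symP => x /=; rewrite symVK. Qed.
Fact sym_mulrV : right_inverse sym_one sym_V sym_mul.
Proof. by move=> p; apply: symP => x /=; rewrite symK. Qed.

HB.instance Definition _ :=
  isGroup.Build sym sym_mulA sym_mul1 sym_mulr1 sym_mulV sym_mulrV.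

End Symmetric.

(* [axet_group] acts on the right: [act x g] is $xg$. *)
Record axet (S : groupType) := Axet {
  axet_group : groupType;
  axet_set :> choiceType;
  act : axet_set -> axet_group -> axet_set;
  tau : axet_set -> S -> axet_group;
  act1 : forall x, act x 1 = x;
  actM : forall x g h, act x (g * h) = act (act x g) h;
  tau_fix : forall x s, act x (tau x s) = x;
  tauM : forall x s s', tau x (s * s') = tau x s * tau x s';
  tauJ : forall x s g, tau (act x g) s = g^-1 * tau x s * g }.

Arguments axet_group {S} _.
Arguments act {S _} x g.
Arguments tau {S _} x s.

Section Morphisms.
Variables (S : groupType) (X X' : axet S).

Definition is_morphism (psi : X -> X') :=
  forall (x y : X) (s : S),
    psi (act y (tau x s)) = act (psi y) (tau (psi x) s).

(* No homomorphism between the groups is part of a morphism of axets. *)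
Definition isomorphic := exists2 psi : X -> X', is_morphism psi & bijective psi.

End Morphisms.

Section AxetTheory.
Variables (S : groupType) (X : axet S).
Local Notation G := (axet_group X).

Definition Miy : set G :=
  smallest (fun H => group_closed (mem H)) [set g | exists x s, g = tau x s].

Lemma Miy_tau (x : X) (s : S) : Miy (tau x s).
Proof. by apply: sub_gen_smallest; exists x, s. Qed.

Lemma Miy_group_closed : group_closed (mem Miy).
Proof.
split; first by apply/mem_set => H [[+ _] _]; rewrite inE.
move=> g h /set_mem Mg /set_mem Mh; apply/mem_set => H HH.
by have [[_ cH] _] := HH; apply/set_mem/cH; apply/mem_set; [apply: Mg|apply: Mh].
Qed.

Lemma actK (x : X) (g : G) : act (act x g) g^-1 = x.
Proof. by rewrite -actM mulgV act1. Qed.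

Section Subaxet.
Variable Y : set X.

Definition setact (g : G) : set X := [set act y g | y in Y].

Definition set_stab : set G := [set g | setact g = Y].

(* Equality rather than [`<=`] is no restriction: [(tau y s)^-1 = tau y s^-1].
   It says exactly that [tau y s] lies in the setwise stabiliser. *)
Definition is_closed := forall (y : X) (s : S), Y y -> setact (tau y s) = Y.

Lemma set_stab_group_closed : group_closed (mem set_stab).
Proof.
split; first by apply/mem_set/seteqP; split=> [_ [y Yy <-]|y Yy];
  [rewrite act1|exists y; rewrite ?act1].
move=> g h /set_mem Yg /set_mem Yh; apply/mem_set/seteqP.
split=> [_ [y Yy <-]|y Yy].
  have : Y (act y g) by rewrite -[X in X _]Yg; exists y.
  by rewrite -[X in X _ -> _]Yh actM => -[z Yz <-]; rewrite actK.
have : Y (act y h) by rewrite -[X in X _]Yh; exists y.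
by rewrite -[X in X _ -> _]Yg => -[z Yz zg]; exists z; rewrite // actM zg actK.
Qed.

Hypothesis cY : is_closed.

Let H := subgroup_type set_stab_group_closed.

Fact sub_act_subproof (y : Y) (g : H) : act (val y) (val g) \in Y.
Proof.
have /set_mem Yg := valP g; apply/mem_set; rewrite -[X in X _]Yg.
by exists (val y) => //; apply/set_mem/(valP y).
Qed.

Fact sub_tau_subproof (y : Y) (s : S) : tau (val y) s \in set_stab.
Proof. by apply/mem_set/cY/set_mem/(valP y). Qed.

Definition sub_act (y : Y) (g : H) : Y := SigSub (sub_act_subproof y g).
Definition sub_tau (y : Y) (s : S) : H := SigSub (sub_tau_subproof y s).

Fact sub_act1 (y : Y) : sub_act y 1 = y.
Proof. by apply: val_inj; rewrite /= act1. Qed.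
Fact sub_actM (y : Y) (g h : H) : sub_act y (g * h) = sub_act (sub_act y g) h.
Proof. by apply: val_inj; rewrite /= actM. Qed.
Fact sub_tau_fix (y : Y) (s : S) : sub_act y (sub_tau y s) = y.
Proof. by apply: val_inj; rewrite /= tau_fix. Qed.
Fact sub_tauM (y : Y) (s s' : S) :
  sub_tau y (s * s') = sub_tau y s * sub_tau y s'.
Proof. by apply: val_inj; rewrite /= tauM. Qed.
Fact sub_tauJ (y : Y) (s : S) (g : H) :
  sub_tau (sub_act y g) s = g^-1 * sub_tau y s * g.
Proof. by apply: val_inj; rewrite /= tauJ. Qed.

Definition subaxet : axet S :=
  Axet sub_act1 sub_actM sub_tau_fix sub_tauM sub_tauJ.

End Subaxet.

Section Factor.
Variable e : rel X.

Definition is_congruence :=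
  equivalence_rel e /\
  forall (x y z w : X) (s : S),
    e x y -> e z w -> e (act x (tau z s)) (act y (tau w s)).

Hypothesis ce : is_congruence.

Fact cong_refl : reflexive e.
Proof. by case/equivalence_relP: ce.1. Qed.
Fact cong_ltrans : left_transitive e.
Proof. by case/equivalence_relP: ce.1. Qed.
Fact cong_sym : symmetric e.
Proof.
move=> x y; apply/idP/idP => xy; first by rewrite -(cong_ltrans xy) cong_refl.
by rewrite -(cong_ltrans xy) cong_refl.
Qed.
Fact cong_trans : transitive e.
Proof. by move=> y x z /cong_ltrans ->. Qed.

Definition cong_equiv : equiv_rel X := EquivRel e cong_refl cong_sym cong_trans.

Local Notation Xbar := {eq_quot cong_equiv}.

Lemma factor_eq (x y : X) :
  \pi_Xbar x = \pi_Xbar y <-> e x y.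
Proof. by split=> [/eqmodP | xy]; last apply/eqmodP. Qed.

Lemma tau1 (x : X) : tau x 1 = 1.
Proof. by apply: (mulgI (tau x 1)); rewrite -tauM !mulg1. Qed.

Lemma tauV (x : X) (s : S) : (tau x s)^-1 = tau x s^-1.
Proof. by apply: (mulgI (tau x s)); rewrite mulgV -tauM mulgV tau1. Qed.

Lemma Miy_cong (x y : X) (g : G) : Miy g -> e x y -> e (act x g) (act y g).
Proof.
pose K : set G := [set g | forall x y, e x y ->
  e (act x g) (act y g) /\ e (act x g^-1) (act y g^-1)].
move=> Mg xy; suff MK : Miy `<=` K by have [] := MK g Mg x y xy.
apply: smallest_sub => [|_ [z [s ->]] u v uv]; last first.
  by rewrite tauV; split; apply: ce.2 => //; exact: cong_refl.
split; first by apply/mem_set => u v uv; rewrite invg1 !act1.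
move=> h k /set_mem Kh /set_mem Kk; apply/mem_set => u v uv.
rewrite invgF !actM.
by split; [apply: (Kk _ _ _).2; apply: (Kh _ _ _).1
          |apply: (Kh _ _ _).2; apply: (Kk _ _ _).1].
Qed.

Lemma MiyV (g : G) : Miy g -> Miy g^-1.
Proof.
move=> Mg; apply/set_mem; have [M1 MV] := Miy_group_closed.
by rewrite -[g^-1]mul1g; apply: MV => //; apply/mem_set.
Qed.

Definition factor_map (g : G) (q : Xbar) : Xbar :=
  \pi_Xbar (act (repr q) g).

Lemma factor_mapE (x : X) (g : G) :
  Miy g -> factor_map g (\pi_Xbar x) = \pi_Xbar (act x g).
Proof.
move=> Mg; apply/factor_eq/Miy_cong => //; apply/factor_eq; exact: reprK.
Qed.

Fact factor_mapK (g : G) : Miy g -> cancel (factor_map g) (factor_map g^-1).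
Proof.
move=> Mg q; rewrite {2}/factor_map factor_mapE; last exact: MiyV.
by rewrite actK reprK.
Qed.

Fact factor_mapVK (g : G) : Miy g -> cancel (factor_map g^-1) (factor_map g).
Proof. by move=> /MiyV /factor_mapK; rewrite invgK. Qed.

Definition factor_perm (g : G) (Mg : Miy g) : sym Xbar :=
  Sym (factor_mapK Mg) (factor_mapVK Mg).

Definition factor_perms : set (sym Xbar) :=
  [set p | exists (g : G) (Mg : Miy g), p = factor_perm Mg].

Lemma factor_perms_group_closed : group_closed (mem factor_perms).
Proof.
have [M1 MV] := Miy_group_closed; split.
  apply/mem_set; exists 1, (set_mem M1); apply: symP => q /=.
  by rewrite /factor_map act1 reprK.
move=> _ _ /set_mem[g [Mg ->]] /set_mem[h [Mh ->]]; apply/mem_set.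
have Mgh : Miy (g / h) by apply/set_mem/MV; apply/mem_set.
exists (g / h), Mgh; apply: symP; elim/quotW=> x.
rewrite -[LHS]/(factor_map h^-1 (factor_map g _)) /=.
by rewrite (factor_mapE x Mg) !factor_mapE ?actM //; exact: MiyV.
Qed.

Let bG := subgroup_type factor_perms_group_closed.

Definition factor_act (q : Xbar) (p : bG) : Xbar := val p q.

Fact factor_tau_subproof (q : Xbar) (s : S) :
  factor_perm (Miy_tau (repr q) s) \in factor_perms.
Proof. by apply/mem_set; exists (tau (repr q) s), (Miy_tau (repr q) s). Qed.

(* The choice of [repr q] does not matter, see [factor_tauE] below. *)
Definition factor_tau (q : Xbar) (s : S) : bG :=
  SigSub (factor_tau_subproof q s).

Lemma factor_tauE (x y : X) (s : S) :
  factor_act (\pi_Xbar y) (factor_tau (\pi_Xbar x) s) =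
  \pi_Xbar (act y (tau x s)).
Proof.
rewrite /factor_act /=; apply/factor_eq/ce.2; apply/factor_eq; exact: reprK.
Qed.

Fact factor_act1 (q : Xbar) : factor_act q 1 = q.
Proof. by []. Qed.
Fact factor_actM (q : Xbar) (p p' : bG) :
  factor_act q (p * p') = factor_act (factor_act q p) p'.
Proof. by []. Qed.
Fact factor_tau_fix (q : Xbar) (s : S) :
  factor_act q (factor_tau q s) = q.
Proof. by rewrite -[q]reprK factor_tauE tau_fix. Qed.
Fact factor_tauM (q : Xbar) (s s' : S) :
  factor_tau q (s * s') = factor_tau q s * factor_tau q s'.
Proof.
apply: val_inj; apply: symP; elim/quotW: q => x; elim/quotW=> y.
rewrite -[LHS]/(factor_act _ _) -[RHS]/(factor_act (factor_act _ _) _).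
by rewrite (factor_tauE x y s) !factor_tauE tauM actM.
Qed.
Fact factor_tauJ (q : Xbar) (s : S) (p : bG) :
  factor_tau (factor_act q p) s = p^-1 * factor_tau q s * p.
Proof.
have /set_mem[g [Mg gE]] := valP p.
have pE x : factor_act (\pi_Xbar x) p = \pi_Xbar (act x g).
  by rewrite /factor_act gE /= factor_mapE.
suff pt : p * factor_tau (factor_act q p) s = factor_tau q s * p.
  by rewrite -mulgA -pt mulKg.
apply: val_inj; apply: symP; elim/quotW: q => x; elim/quotW=> y.
rewrite -[LHS]/(factor_act (factor_act _ _) _).
rewrite -[RHS]/(factor_act (factor_act _ _) _).
rewrite (pE x) (pE y) (factor_tauE x y s) pE factor_tauE.
by rewrite tauJ -!actM !mulgA mulgV mul1g.
Qed.

Definition factor : axet S :=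
  Axet factor_act1 factor_actM factor_tau_fix factor_tauM factor_tauJ.

End Factor.
End AxetTheory.

(* Main.v *)
Require Import Defs.
From HB Require Import structures.
From mathcomp Require Import all_boot.
From mathcomp Require Import boolp classical_sets.

(** This is the first isomorphism theorem for axets.  A morphism carries the
    action of [tau x s] on [X] to the action of [tau (psi x) s] on [psi(X)], and
    this single identity gives everything.  It shows that [tau (psi x) s] sends
    [psi(X)] into itself; as its inverse is [tau (psi x) s^-1], it sends [psi(X)]
    onto itself ([range_closed]).  It also shows that [psi (act x (tau z s))]
    depends only on [psi x] and [psi z], so the kernel relation is a congruence
    ([kernel_congruence]).  Finally, sending a point of [psi(X)] to the class of
    any of its preimages is a bijection onto the set of classes, independent of
    the preimage chosen, and the same identity makes it a morphism
    ([image_to_class_morphism], [image_to_class_bij]).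

    No comparison of groups is involved: a morphism of axets is only a map of
    sets compatible with the actions of the [tau x s]. *)

Local Open Scope classical_set_scope.

Section FirstIsomorphism.
Local Open Scope group_scope.
Local Open Scope quotient_scope.
Context {S : groupType} {X X' : axet S} {psi : X -> X'}.
Hypothesis psiM : is_morphism psi.

Lemma range_closed : is_closed (range psi).
Proof.
move=> _ s [x _ <-]; apply/seteqP; split=> [_ [_ [y _ <-] <-]|_ [y _ <-]].
  by exists (act y (tau x s)); rewrite // psiM.
exists (psi (act y (tau x s^-1))); first by exists (act y (tau x s^-1)).
by rewrite -psiM -tauV -{2}[tau x s]invgK actK.
Qed.

Lemma kernel_congruence : is_congruence [rel x y | psi x == psi y].
Proof.
split=> [|x y z w s /= /eqP xy /eqP zw]; last by rewrite !psiM xy zw.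
by apply/equivalence_relP; split=> [x|x y /= /eqP xy z] /=; rewrite ?eqxx ?xy.
Qed.

Local Notation img := (subaxet range_closed).
Local Notation quo := (factor kernel_congruence).
Local Notation classes := {eq_quot cong_equiv kernel_congruence}.

Fact preimage_subproof (y : img) : exists x, psi x = val y.
Proof. by have /set_mem[x _ xy] := valP y; exists x. Qed.

Definition preimage_pt (y : img) : X := sval (cid (preimage_subproof y)).

Lemma preimage_ptK (y : img) : psi (preimage_pt y) = val y.
Proof. exact: svalP (cid (preimage_subproof y)). Qed.

Definition image_to_class (y : img) : quo := \pi_classes (preimage_pt y).

(** The class does not depend on the preimage, since two preimages of a point
    are related by definition of the kernel relation. *)
Lemma image_to_classE (y : img) (x : X) :
  psi x = val y -> image_to_class y = \pi_classes x.
Proof. by move=> xy; apply/factor_eq; rewrite /= preimage_ptK xy. Qed.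

(** If [u] and [v] are preimages of [x] and [y], then [act v (tau u s)] is a
    preimage of [act y (tau x s)], and its class can be used for the latter. *)
Lemma image_to_class_morphism : is_morphism image_to_class.
Proof.
move=> x y s; rewrite [RHS](factor_tauE kernel_congruence).
by apply: image_to_classE; rewrite psiM !preimage_ptK.
Qed.

Lemma image_to_class_bij : bijective image_to_class.
Proof.
have im (q : quo) : psi (repr q) \in range psi.
  by apply/mem_set; exists (repr q).
exists (fun q => SigSub (im q) : img) => [y|q].
  apply: val_inj => /=; rewrite -[RHS]preimage_ptK; apply/eqP.
  by apply/(factor_eq kernel_congruence); rewrite reprK.
by rewrite (@image_to_classE _ (repr q)) // reprK.
Qed.

End FirstIsomorphism.

Theorem theorem3p17 (S : groupType) (X X' : axet S) (psi : X -> X')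
    (psiM : is_morphism psi) :
  exists (cY : is_closed (range psi)) (ce : is_congruence [rel x y | psi x == psi y]),
    isomorphic (subaxet cY) (factor ce).
Proof.
exists (range_closed psiM), (kernel_congruence psiM), (image_to_class psiM).
- exact: image_to_class_morphism.
- exact: image_to_class_bij.
Qed.
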